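(* Let $n \ge 2$ and let $a_1, \dots, a_n$ be non-negative real numbers. Then \[ \frac{1}{n!} \sum_{\pi \in S_n} \left[\prod_{i\in\mathrm{fix}(\pi)} a_i\right] \ge \frac{1}{\binom{n}{2}} \sum_{S \in\binom{[n]}{2}} \left(\prod_{i \in S} a_i \right)^{1/2}. \] Furthermore, provided $n \ge 3$, equality holds if and only if $a_i = 1$ for all $1 \le i \le n$.
   Context: $S_n$ denotes the symmetric group on $[n] = \{1, \dots, n\}$, $\mathrm{fix}(\pi) = \{i \in [n] : \pi(i) = i\}$ is the set of fixed points of $\pi$, and $\binom{[n]}{2}$ is the family of $2$-element subsets of $[n]$. A product over the empty set equals $1$. *)

(* Defs.v *)
From HB Require Import structures.
From mathcomp Require Import all_boot all_order all_algebra all_fingroup.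
From mathcomp Require Import reals.

Set Implicit Arguments.
Unset Strict Implicit.
Unset Printing Implicit Defensive.

Import Order.TTheory GRing.Theory Num.Theory.

Local Open Scope ring_scope.

Definition fix_set (n : nat) (s : 'S_n) : {set 'I_n} := [set i | s i == i].

Definition perm_average (R : realType) (n : nat) (a : 'I_n -> R) : R :=
  (n`!)%:R^-1 * \sum_(s : 'S_n) \prod_(i in fix_set s) a i.

Definition pair_average (R : realType) (n : nat) (a : 'I_n -> R) : R :=
  ('C(n, 2))%:R^-1 *
    \sum_(S : {set 'I_n} | #|S| == 2%N) Num.sqrt (\prod_(i in S) a i).

(* Main.v *)
(**
  Put [x_i = sqrt (a_i)] and [b_i = a_i - 1]. Expanding the product over
  [fix(pi)] in the [b_i] gives
    [n! (LHS - RHS) = f([n])],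
    [f(A) = \sum_(T \subset A) (|A| - |T|)! w(T)],
  with [w(T) = \prod_(i in T) b_i], lowered by [2 x_i x_j] if [T = {i, j}].
  Such sums satisfy [f(A) = \sum_(i in A) f(A \ i) + w(A)], and induction on
  [|A| >= 2] proves the stronger bound [f(A) >= max(0, \prod_(i in A) b_i)].
  For [|A| = 2], [f(A) = (1 - x_i x_j)^2 >= b_i b_j]. For [|A| >= 3] only the
  case [\prod_(i in A) b_i < 0] is not immediate; then some [b_i] lies in
  [[-1, 0)], and the term [f(A \ i) >= \prod_(j in A \ i) b_j] outweighs [w(A)].
*)
Require Import Defs.
From HB Require Import structures.
From mathcomp Require Import all_boot all_order all_algebra all_fingroup.
From mathcomp Require Import reals.
From mathcomp Require Import ring lra.

Set Implicit Arguments.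
Unset Strict Implicit.
Unset Printing Implicit Defensive.

Import Order.TTheory GRing.Theory Num.Theory.

Local Open Scope ring_scope.

Definition fact_sum (R : realFieldType) (I : finType) (w : {set I} -> R)
    (A : {set I}) : R :=
  \sum_(T : {set I} | T \subset A) ((#|A| - #|T|)`!)%:R * w T.

(** A proper subset [T] of [A] lies in [A :\ i] for exactly [|A| - |T|] indices [i], and this count
    times [(|A| - 1 - |T|)!] is [(|A| - |T|)!]. The remaining term [T = A] is [w A]. *)
Lemma fact_sum_rec (R : realFieldType) (I : finType) (w : {set I} -> R)
    (A : {set I}) :
  fact_sum w A = \sum_(i in A) fact_sum w (A :\ i) + w A.
Proof.
rewrite /fact_sum (bigD1 A) //= subnn fact0 mul1r addrC; congr (_ + _).
rewrite (exchange_big_dep (fun T : {set I} => (T \subset A) && (T != A))) /=.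
  apply: eq_bigr => T /andP [sTA neTA].
  have prTA : (#|T| < #|A|)%N by rewrite proper_card // properEneq neTA.
  rewrite (eq_bigl (mem (A :\: T))); last first.
    by move=> i; rewrite subsetD1 !inE sTA andbC.
  rewrite (eq_bigr (fun _ => ((#|A|.-1 - #|T|)`!)%:R * w T)); last first.
    by move=> i /setDP [iA _]; rewrite (cardsD1 i A) iA.
  rewrite sumr_const cardsD (setIidPr sTA) -mulrnAl -mulrnA mulnC.
  by rewrite -[(#|A| - #|T|)%N]prednK ?subn_gt0 // factS -!subn1 subnAC.
move=> i T iA; rewrite subsetD1 => /andP [-> niT] /=.
by apply: contraNneq niT => ->.
Qed.

Lemma fact_sum0 (R : realFieldType) (I : finType) (w : {set I} -> R) :
  fact_sum w set0 = w set0.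
Proof. by rewrite fact_sum_rec big_set0 add0r. Qed.

Lemma fact_sum1 (R : realFieldType) (I : finType) (w : {set I} -> R) (i : I) :
  fact_sum w [set i] = w set0 + w [set i].
Proof. by rewrite fact_sum_rec big_set1 setDv fact_sum0. Qed.

Lemma fact_sum2 (R : realFieldType) (I : finType) (w : {set I} -> R)
    (i j : I) : i != j ->
  fact_sum w [set i; j] = w set0 *+ 2 + w [set i] + w [set j] + w [set i; j].
Proof.
move=> neij; rewrite fact_sum_rec big_setU1 ?inE // big_set1 /=.
rewrite setU1K ?inE // setUC setU1K ?inE 1?eq_sym // !fact_sum1.
by rewrite [[set j] :|: _]setUC; ring.
Qed.

Lemma fact_sumT (R : realFieldType) (I : finType) (w : {set I} -> R) :
  fact_sum w setT = \sum_(T : {set I}) ((#|I| - #|T|)`!)%:R * w T.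
Proof. by rewrite /fact_sum cardsT; apply: eq_bigl => T; rewrite subsetT. Qed.

(** Taking the roots [x i] as variables keeps the weight polynomial. The boolean, read as 0 or 1,
    restricts the correction to pairs. *)
Definition gap_weight (R : realFieldType) (I : finType) (x : I -> R)
    (T : {set I}) : R :=
  \prod_(i in T) (x i ^+ 2 - 1) - (\prod_(i in T) x i) *+ (2 * (#|T| == 2%N)).

Lemma gap2 (R : realFieldType) (I : finType) (x : I -> R) (i j : I) :
  i != j -> fact_sum (gap_weight x) [set i; j] = (1 - x i * x j) ^+ 2.
Proof.
move=> neij; rewrite fact_sum2 // /gap_weight cards0 !cards1 cards2 neij /=.
by rewrite !big_setU1 ?inE //= !big_set1 big_set0; ring.
Qed.

Lemma gap_rec (R : realFieldType) (I : finType) (x : I -> R) (A : {set I}) :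
  (2 < #|A|)%N ->
  fact_sum (gap_weight x) A =
  \sum_(i in A) fact_sum (gap_weight x) (A :\ i)
  + \prod_(i in A) (x i ^+ 2 - 1).
Proof.
by move=> A_gt2; rewrite fact_sum_rec /gap_weight gtn_eqF // muln0 mulr0n subr0.
Qed.

Lemma prod_lt0_ex (R : realFieldType) (I : finType) (b : I -> R)
    (A : {set I}) :
  \prod_(i in A) b i < 0 -> exists2 i, i \in A & b i < 0.
Proof.
move=> prod_lt0; apply/exists_inP; apply: contraLR prod_lt0.
rewrite negb_exists_in -leNgt => /forall_inP b_ge0.
by apply: prodr_ge0 => i iA; rewrite leNgt b_ge0.
Qed.

Lemma gap_lower_bound (R : realFieldType) (I : finType) (x : I -> R)
    (A : {set I}) : (2 <= #|A|)%N ->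
  0 <= fact_sum (gap_weight x) A /\
  \prod_(i in A) (x i ^+ 2 - 1) <= fact_sum (gap_weight x) A.
Proof.
have [m] := ubnP #|A|; elim: m A => // m IHm A leAm.
rewrite leq_eqVlt => /orP [/eqP/esym/eqP/cards2P [i [j [neij ->]]]|A_gt2].
  rewrite gap2 // big_setU1 ?inE //= big_set1; split; first exact: sqr_ge0.
  (* The difference of the two sides is [(x i - x j) ^+ 2]. *)
  by have := sqr_ge0 (x i - x j); nra.
have cardD i : i \in A -> (#|A| = #|A :\ i|.+1)%N.
  by move=> iA; rewrite (cardsD1 i) iA.
have {}IHm i (iA : i \in A) : 0 <= fact_sum (gap_weight x) (A :\ i) /\
    \prod_(j in A :\ i) (x j ^+ 2 - 1) <= fact_sum (gap_weight x) (A :\ i).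
  by apply: IHm; rewrite -ltnS -cardD.
rewrite gap_rec //.
have sum_ge0 : 0 <= \sum_(i in A) fact_sum (gap_weight x) (A :\ i).
  by apply: sumr_ge0 => i /IHm [].
split; last by rewrite lerDr.
have [prod_ge0|prod_lt0] := leP 0 (\prod_(i in A) (x i ^+ 2 - 1)).
  exact: addr_ge0.
have [i iA bi_lt0] := prod_lt0_ex prod_lt0.
have [_ fi_ge] := IHm i iA.
have rest_ge0 :
    0 <= \sum_(j in A | j != i) fact_sum (gap_weight x) (A :\ j).
  by apply: sumr_ge0 => j /andP [/IHm []].
move: prod_lt0; rewrite (big_setD1 i) //= => prod_lt0.
(* Let [P] be the product over [A :\ i]; it is positive. The bound [f(A \ i) >= P] leaves at least
   [P + b_i P = x_i^2 P >= 0]. *)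
rewrite (bigD1 i) //=; have := sqr_ge0 (x i); nra.
Qed.

(** Supplies an index whose deletion keeps both [i] and [j]; the case [i = j] is allowed. *)
Lemma ex_third (I : finType) (i j : I) (A : {set I}) :
  (2 < #|A|)%N -> exists2 k, k \in A & (k != i) && (k != j).
Proof.
move=> A_gt2; have /card_gt0P [k] : (0 < #|A :\: [set i; j]|)%N.
  rewrite cardsD subn_gt0 (leq_ltn_trans _ A_gt2) //.
  rewrite (leq_trans (subset_leq_card (subsetIr _ _))) // cards2.
  by case: (_ != _).
by rewrite !inE negb_or => /andP [neq kA]; exists k.
Qed.

(** For a pair, [gap2] gives a vanishing square. For larger [A] with nonnegative product, every
    [f(A \ k)] in the recursion vanishes, and each pair survives the deletion of some third [k]. *)
Lemma gap_eq0 (R : realFieldType) (I : finType) (x : I -> R) (A : {set I}) :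
  (2 <= #|A|)%N -> fact_sum (gap_weight x) A = 0 ->
  {in A &, forall i j, i != j -> x i * x j = 1}.
Proof.
have [m] := ubnP #|A|; elim: m A => // m IHm A leAm.
rewrite leq_eqVlt => /orP [/eqP/esym/eqP/cards2P [i [j [neij ->]]]|A_gt2].
  rewrite gap2 // => /eqP; rewrite sqrf_eq0 subr_eq0 => /eqP xij1.
  move=> k l /set2P [] -> /set2P [] ->; rewrite ?eqxx // => _.
  by rewrite mulrC.
have cardD i : i \in A -> (#|A| = #|A :\ i|.+1)%N.
  by move=> iA; rewrite (cardsD1 i) iA.
have IH k i j : k \in A -> fact_sum (gap_weight x) (A :\ k) = 0 ->
    i \in A -> j \in A -> k != i -> k != j -> i != j -> x i * x j = 1.
  move=> kA fk0 iA jA neki nekj; apply: (IHm (A :\ k)) => //.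
  - by rewrite -ltnS -cardD.
  - by rewrite -ltnS -cardD.
  - by rewrite !inE eq_sym neki.
  - by rewrite !inE eq_sym nekj.
have bound k (kA : k \in A) : 0 <= fact_sum (gap_weight x) (A :\ k) /\
    \prod_(j in A :\ k) (x j ^+ 2 - 1) <= fact_sum (gap_weight x) (A :\ k).
  by apply: gap_lower_bound; rewrite -ltnS -cardD.
rewrite gap_rec // => f0.
have [prod_ge0|prod_lt0] := leP 0 (\prod_(i in A) (x i ^+ 2 - 1)).
  have sum_ge0 : 0 <= \sum_(i in A) fact_sum (gap_weight x) (A :\ i).
    by apply: sumr_ge0 => i /bound [].
  move=> i j iA jA neij; have [k kA /andP [neki nekj]] := ex_third i j A_gt2.
  have sum0 : \sum_(l in A) fact_sum (gap_weight x) (A :\ l) = 0 by lra.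
  have fk0 := psumr_eq0P (fun l lA => (bound l lA).1) sum0.
  exact: (IH k i j kA (fk0 k kA)).
(* Here [b_i < 0] forces [x_i = 0] and [f(A \ j) = 0] for [j != i], which the
   induction hypothesis excludes. *)
have [i iA bi_lt0] := prod_lt0_ex prod_lt0.
have [j jA /andP [neji _]] := ex_third i i A_gt2.
have [k kA /andP [neki nekj]] := ex_third i j A_gt2.
have rest_ge0 :
    0 <= \sum_(l in A | (l != i) && (l != j)) fact_sum (gap_weight x) (A :\ l).
  by apply: sumr_ge0 => l /andP [/bound []].
move: prod_lt0 f0; rewrite (big_setD1 i) //= => prod_lt0.
rewrite (bigD1 i) //= (bigD1 j) /=; last by rewrite jA.
rewrite (eq_bigl (fun l => (l \in A) && ((l != i) && (l != j)))); last first.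
  by move=> l; rewrite -andbA.
move=> f0.
have [_ fi_ge] := bound i iA; have [fj_ge0 _] := bound j jA.
have prod_gt0 : 0 < \prod_(l in A :\ i) (x l ^+ 2 - 1) by nra.
have xi2_ge0 := sqr_ge0 (x i).
(* With [P > 0] the product over [A :\ i], the recursion gives [0 >= x_i^2 P + f(A \ j)], where both
   terms are nonnegative. *)
have fj0 : fact_sum (gap_weight x) (A :\ j) = 0 by nra.
have xi2_0 : x i ^+ 2 = 0 by nra.
have nejk : j != k by rewrite eq_sym.
have neik : i != k by rewrite eq_sym.
have := IH j i k jA fj0 iA kA neji nejk neik.
move: xi2_0 => /eqP; rewrite sqrf_eq0 => /eqP ->.
by rewrite mul0r => /esym/eqP; rewrite oner_eq0.
Qed.

Lemma prod_subset_expansion (R : comPzRingType) (I : finType) (a : I -> R)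
    (A : {set I}) :
  \prod_(i in A) a i =
  \sum_(T : {set I} | T \subset A) \prod_(i in T) (a i - 1).
Proof.
(* Extension by 0 makes the factors [F i + 1] outside [A] equal to 1 and kills every [T] not inside
   [A], so distributivity over all of [I] applies. *)
pose F i := if i \in A then a i - 1 else 0.
transitivity (\prod_i (F i + 1)).
  rewrite big_mkcond; apply: eq_bigr => i _; rewrite /F.
  by case: ifP => _; rewrite ?subrK ?add0r.
rewrite bigA_distr [RHS]big_mkcond; apply: eq_bigr => T _; rewrite -big_mkcond.
have [/subsetP sTA|/subsetPn [i iT niA]] := boolP (T \subset A).
  by apply: eq_bigr => i /sTA iA; rewrite /F iA.
by rewrite (bigD1 i) //= /F (negbTE niA) mul0r.
Qed.

(** Fixing [T] pointwise means moving only points of [~: T], so [card_perm] counts these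
    permutations. *)
Lemma card_perm_fixing (I : finType) (T : {set I}) :
  #|[set s : {perm I} | T \subset [set i | s i == i]]| = (#|I| - #|T|)`!.
Proof.
have -> : (#|I| - #|T| = #|~: T|)%N by rewrite [RHS]cardsCs setCK.
rewrite -card_perm; apply: eq_card => s; rewrite !inE.
apply/subsetP/subsetP => [fixT i|onT i iT].
  by rewrite !inE; apply: contra => /fixT; rewrite inE.
by rewrite inE; apply: contraTT iT => /onT; rewrite inE.
Qed.

(** After expanding and exchanging sums, each [T] occurs once per permutation fixing it pointwise,
    hence [(n - |T|)!] times. *)
Lemma sum_perm_fix (R : realType) (n : nat) (a : 'I_n -> R) :
  \sum_(s : 'S_n) \prod_(i in fix_set s) a i =
  fact_sum (fun T : {set 'I_n} => \prod_(i in T) (a i - 1)) [set: 'I_n].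
Proof.
rewrite fact_sumT.
transitivity (\sum_(s : 'S_n) \sum_(T : {set 'I_n} | T \subset fix_set s)
    \prod_(i in T) (a i - 1)).
  by apply: eq_bigr => s _; exact: prod_subset_expansion.
rewrite (exchange_big_dep xpredT) //=.
apply: eq_bigr => T _; rewrite sumr_const -card_perm_fixing mulr_natl.
by congr (_ *+ _); apply: eq_card => s; rewrite !inE.
Qed.

Lemma sqrtr_prod (R : rcfType) (I : finType) (P : pred I) (a : I -> R) :
  (forall i, 0 <= a i) ->
  Num.sqrt (\prod_(i | P i) a i) = \prod_(i | P i) Num.sqrt (a i).
Proof.
move=> a_ge0; elim/big_rec2: _ => [|i y z _ <-]; first exact: sqrtr1.
exact: sqrtrM.
Qed.

Lemma gap_setT (R : realType) (n : nat) (a : 'I_n -> R) : (2 <= n)%N ->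
  (forall i, 0 <= a i) ->
  fact_sum (gap_weight (fun i => Num.sqrt (a i))) [set: 'I_n] =
  n`!%:R * (perm_average a - pair_average a).
Proof.
move=> n_ge2 a_ge0; rewrite mulrBr /perm_average /pair_average.
have nfact_neq0 : n`!%:R != 0 :> R by rewrite pnatr_eq0 -lt0n fact_gt0.
rewrite mulVKf // sum_perm_fix mulrA.
(* This is the coefficient of a pair in [fact_sum], times the 2 in [gap_weight]. *)
have -> : n`!%:R * 'C(n, 2)%:R^-1 = (2 * (n - 2)`!)%:R :> R.
  have bin_neq0 : 'C(n, 2)%:R != 0 :> R by rewrite pnatr_eq0 -lt0n bin_gt0.
  by apply: (mulIf bin_neq0); rewrite mulfVK // -natrM -(bin_fact n_ge2) mulnC.
rewrite mulr_sumr [X in _ - X]big_mkcond !fact_sumT card_ord -sumrB.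
apply: eq_bigr => T _; rewrite /gap_weight mulrBr.
rewrite (eq_bigr (fun i => a i - 1)); last by move=> i _; rewrite sqr_sqrtr.
congr (_ - _); have [->|_] := eqVneq; last by rewrite muln0 mulr0n mulr0.
by rewrite sqrtr_prod // muln1 natrM; ring.
Qed.

Theorem theorem1p1 (R : realType) (n : nat) (a : 'I_n -> R)
    (n_ge2 : (2 <= n)%N) (a_ge0 : forall i : 'I_n, 0 <= a i) :
  perm_average a >= pair_average a
  /\ ((3 <= n)%N ->
      (perm_average a = pair_average a <-> forall i : 'I_n, a i = 1)).
Proof.
have cardT : (2 <= #|[set: 'I_n]|)%N by rewrite cardsT card_ord.
have gapE := gap_setT n_ge2 a_ge0.
have nfact_gt0 : 0 < n`!%:R :> R by rewrite ltr0n fact_gt0.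
split.
  have [] := gap_lower_bound (fun i => Num.sqrt (a i)) cardT.
  by rewrite gapE pmulr_rge0 // subr_ge0.
move=> n_ge3; split=> [eq_avg i|a1].
  have prod1 := gap_eq0 cardT (etrans gapE _).
  have {}prod1 j k : j != k -> a j * a k = 1.
    move=> nejk; rewrite -[a j]sqr_sqrtr // -[a k]sqr_sqrtr // -exprMn.
    by rewrite prod1 ?inE ?expr1n // eq_avg subrr mulr0.
  have cardT3 : (2 < #|[set: 'I_n]|)%N by rewrite cardsT card_ord.
  have [j _ /andP [neji _]] := ex_third i i cardT3.
  have [k _ /andP [neki nekj]] := ex_third i j cardT3.
  have ji := prod1 j i neji; have ki := prod1 k i neki.
  have kj := prod1 k j nekj.
  (* Multiplying [ji] and [ki] and using [kj] gives [a i ^+ 2 = 1]; nonnegativity selects the root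
     1. *)
  have := a_ge0 i; nra.
rewrite /perm_average /pair_average.
rewrite [X in _ * X = _](eq_bigr (fun=> 1)); last first.
  by move=> s _; apply: big1 => i _.
rewrite [X in _ = _ * X](eq_bigr (fun=> 1)); last first.
  by move=> S _; rewrite big1 ?sqrtr1.
rewrite !sumr_const card_Sn.
have -> : #|[pred S : {set 'I_n} | #|S| == 2%N]| = 'C(n, 2).
  by rewrite -[X in 'C(X, 2)]card_ord -card_draws cardsE.
by rewrite !mulVf // pnatr_eq0 -lt0n ?fact_gt0 ?bin_gt0.
Qed.
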